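(* Let $f$, $M$ satisfy the standing assumptions (1)–(3) of the context, suppose moreover that $\nabla^2 f(X)$ exists at every $X\in\mathbb{R}^{n\times p}$, and suppose $\beta\ge\tilde\beta$. If $X\in\mathbb{R}^{n\times p}$ is a first-order stationary point of $h$, then one of the following holds: (1) $X\in\mathcal{S}_M(n,p)$, and hence $X$ is a first-order stationary point of the constrained problem (P); (2) $X\notin\mathcal{S}_M(n,p)$, and hence $X$ is a strict saddle point of $h$.
   Context: Let $1\le p\le n$ be integers, $f:\mathbb{R}^{n\times p}\to\mathbb{R}$ with $f(X)=\mathbb{E}_{\xi\sim\Xi}[f_\xi(X)]$, and $M=\mathbb{E}_{\theta\sim\Theta}[M_\theta]\in\mathbb{R}^{n\times n}$, where $\xi,\theta$ are random vectors with distributions $\Xi,\Theta$. Standing assumptions: (1) $f$ is differentiable and $\nabla f$ is globally $L_g$-Lipschitz continuous on $\mathbb{R}^{n\times p}$; (2) for almost every $\xi$, $f_\xi$ is differentiable, and $\mathbb{E}_{\xi\sim\Xi}[\nabla f_\xi(X)]=\nabla f(X)$ for all $X$; (3) $M$ is symmetric positive definite. Problem (P): minimize $f(X)$ over $X\in\mathcal{S}_M(n,p):=\{X\in\mathbb{R}^{n\times p}:X^\top MX=I_p\}$. Notation: $\|\cdot\|$ is the Frobenius norm, $\langle X,Y\rangle=\operatorname{tr}(X^\top Y)$; $\sigma_{\max}(\cdot),\sigma_{\min}(\cdot)$ are the largest and smallest singular values; $\kappa(M)=\sigma_{\max}(M)/\sigma_{\min}(M)$; $L_0:=\|\nabla f(0)\|$;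 $\Psi(A):=\tfrac12(A+A^\top)$. Define $\mathcal{A}(X):=X\left(\tfrac32 I_p-\tfrac12X^\top MX\right)$ and, for a penalty parameter $\beta>0$, $$h(X):=f(\mathcal{A}(X))+\frac{\beta}{6}\operatorname{tr}\left(X^\top MX\left((X^\top MX)^2-3I_p\right)\right).$$ $\tilde\beta$ denotes a constant satisfying $$\tilde\beta\ge\frac{12\,\kappa(M)\left(3(p+1)L_g+\sigma_{\min}(M)^{1/2}L_0\right)}{\sigma_{\min}(M)}.$$ $X$ is a first-order stationary point of (P) iff $X^\top MX=I_p$ and $\nabla f(X)-MX\Psi(X^\top\nabla f(X))=0$. $X$ is a first-order stationary point of $h$ iff $\nabla h(X)=0$. $X$ is a strict saddle point of $h$ iff it is a first-order stationary point of $h$ and there are $c>0$ and a nonzero $D\in\mathbb{R}^{n\times p}$ with $\langle D,\nabla^2h(X)[D]\rangle\le -c\|D\|^2$. *)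

(* Defs.v *)
From mathcomp Require Import all_boot all_order all_algebra.
From mathcomp Require Import all_classical all_reals all_analysis.

Set Implicit Arguments.
Unset Strict Implicit.
Unset Printing Implicit Defensive.

Import Order.TTheory GRing.Theory Num.Theory.
Import numFieldNormedType.Exports.

Local Open Scope classical_set_scope.
Local Open Scope ring_scope.

Section Matrices.
Context {R : realType}.

(* The library norm `|X| on matrices is the sup norm, which is not used here. *)
Definition frob_inner {m q : nat} (X Y : 'M[R]_(m, q)) : R := \tr (X^T *m Y).

Definition frob_norm {m q : nat} (X : 'M[R]_(m, q)) : R :=
  Num.sqrt (frob_inner X X).

Definition sym_part {m : nat} (B : 'M[R]_m) : 'M[R]_m := 2^-1 *: (B + B^T).

Definition symmetric_posdef {m : nat} (M : 'M[R]_m) : Prop :=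
  M^T = M /\ forall v : 'cV[R]_m, v != 0 -> 0 < (v^T *m M *m v) 0 0.

Definition singular_values {m : nat} (M : 'M[R]_m) : set R :=
  [set s : R | 0 <= s /\ eigenvalue (M^T *m M) (s ^+ 2)].

(* The set of singular values is finite, and nonempty for m > 0, so sup and
   inf are a maximum and a minimum. *)
Definition sigma_max {m : nat} (M : 'M[R]_m) : R := sup (singular_values M).

Definition sigma_min {m : nat} (M : 'M[R]_m) : R := inf (singular_values M).

Definition cond_number {m : nat} (M : 'M[R]_m) : R :=
  sigma_max M / sigma_min M.

End Matrices.

Section Derivatives.
Context {R : realType} {n p : nat}.
Implicit Types (g : 'M[R]_(n, p) -> R^o) (X : 'M[R]_(n, p)).

(* Gradient for the Frobenius inner product; only meaningful where g is
   differentiable, since 'd is a default linear map elsewhere. *)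
Definition grad g X : 'M[R]_(n, p) := \matrix_(i, j) 'd g X (delta_mx i j).

Definition has_hessian g X : Prop :=
  (\forall Y \near X, differentiable g Y) /\ differentiable (grad g) X.

Definition hess g X : 'M[R]_(n, p) -> 'M[R]_(n, p) := 'd (grad g) X.

Definition stationary g X : Prop := differentiable g X /\ grad g X = 0.

Definition strict_saddle g X : Prop :=
  [/\ stationary g X, has_hessian g X &
      exists c : R, 0 < c /\ exists D : 'M[R]_(n, p), D != 0 /\
        frob_inner D (hess g X D) <= - c * frob_norm D ^+ 2].

Definition lipschitz_grad (L : R) g : Prop :=
  forall X Y, frob_norm (grad g X - grad g Y) <= L * frob_norm (X - Y).

End Derivatives.

Section Expectations.
Context {R : realType} {d : measure_display} {T : measurableType d}.

(* The expectation of Y exists and equals a. The random quantity Y, such as a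
   gradient that exists only almost surely, may be defined only up to a null
   set, hence the passage to an integrable representative Z. *)
Definition has_expectation (P : probability T R) (Y : T -> R) (a : R) : Prop :=
  exists Z : T -> R,
    [/\ P.-integrable setT (EFin \o Z),
        {ae P, forall t, Y t = Z t} &
        'E_P[Z] = a%:E]%E.

Definition has_mx_expectation {m q : nat} (P : probability T R)
    (Y : T -> 'M[R]_(m, q)) (B : 'M[R]_(m, q)) : Prop :=
  forall i j, has_expectation P (fun t => Y t i j) (B i j).

End Expectations.

Section Problem.
Context {R : realType} {n p : nat}.
Variables (f : 'M[R]_(n, p) -> R^o) (M : 'M[R]_n).
Implicit Type X : 'M[R]_(n, p).

Definition gen_stiefel : set 'M[R]_(n, p) := [set X | X^T *m M *m X = 1%:M].

Definition stationary_on_stiefel X : Prop :=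
  gen_stiefel X /\
  grad f X - M *m X *m sym_part (X^T *m grad f X) = 0.

Definition dissolving X : 'M[R]_(n, p) :=
  X *m ((3 / 2)%:M - 2^-1 *: (X^T *m M *m X)).

Definition penalty (beta : R) X : R^o :=
  let S := X^T *m M *m X in
  f (dissolving X) + beta / 6 * \tr (S *m (S *m S - 3%:M)).

Definition penalty_bound (Lg : R) : R :=
  12 * cond_number M *
    (3 * p.+1%:R * Lg + Num.sqrt (sigma_min M) * frob_norm (grad f 0))
  / sigma_min M.

End Problem.

(* Main.v *)
From HB Require Import structures.
Require Import Defs.
From mathcomp Require Import all_boot all_order all_algebra.
From mathcomp Require Import all_classical all_reals all_analysis.
From mathcomp Require Import ring lra.
Import Order.TTheory GRing.Theory Num.Theory.
Import numFieldNormedType.Exports.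
Local Open Scope classical_set_scope.
Local Open Scope ring_scope.

Set Implicit Arguments.
Unset Strict Implicit.
Unset Printing Implicit Defensive.

(** Write S = X^T M X, A(X) = X (3/2 - S/2), G = grad f (A(X)), and
    m = sigma_min M.  Differentiating h gives
      grad h X = G (3/2 - S/2) - M X sym (X^T G) + beta M X (S^2 - 1),
    so when S = 1 one has A(X) = X and grad h X = 0 is literally the
    stationarity condition on the manifold.  It remains to treat S <> 1.

    Let S v = s v with |v| = 1.  Pairing grad h X = 0 with the rank-one matrix
    X v v^T makes every term a multiple of 1 - s
    ([stationary_eigenpair]):
      (1 - s) (3/2 <Xv, Gv> - beta s (1 + s)) = 0.
    If s <> 1 and s > 0, Cauchy-Schwarz and m |Xv|^2 <= s bound
    beta m sqrt s (1 + s) by a multiple of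
    sqrt m |G| <= sqrt m |grad f 0| + Lg sqrt m |A(X)|.  The norm of A(X) is
    controlled by the quadratic form of S (3/2 - S/2)^2, hence by the largest
    eigenvalue of S; as beta is large, that eigenvalue cannot exceed 4, and then
    every eigenvalue other than 1 is at most 1/64
    ([stationary_eigenvalue_dichotomy]).

    So if S <> 1 there is an eigenvector v with eigenvalue s <= 1/64.  Move along
    D = w v^T with w = X v, or, when X v = 0, with w any nonzero vector such that
    X^T M w = 0 (one exists since X is then column-rank deficient and p <= n).
    Both choices satisfy X^T M w = s v, so that D is an eigenvector of the
    derivative of A, and with q = <w, M w>
      <D, hess h X D> = (3/2 (1 - s))^2 <D, hess f (A X) D> - 3 s <w, Gv>
                        + beta (q (s^2 - 1) + 4 s^3)
    ([penalty_hess_rank1]).  The middle term is nonpositive by the eigenpair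
    identity, s^2 = s q turns the last one into beta q (5 s^2 - 1), and
    the first is at most 9/4 Lg |w|^2 <= 9/4 Lg q / m, which is small against
    beta q.  The sum is negative.

    The spectral input is only that a symmetric matrix has a unit eigenvector
    minimizing its quadratic form ([min_eigenvector], by compactness of the
    sphere); applied to M it also identifies sigma_min M. *)

(** * The Frobenius inner product *)

Section Frobenius.
Context {R : realType} {m q : nat}.
Implicit Types X Y D : 'M[R]_(m, q).

Lemma frob_innerE X Y : frob_inner X Y = \sum_i \sum_j X i j * Y i j.
Proof.
rewrite /frob_inner exchange_big; apply: eq_bigr => j _.
by rewrite mxE; apply: eq_bigr => i _; rewrite mxE.
Qed.

Lemma frob_innerC X Y : frob_inner X Y = frob_inner Y X.
Proof. by rewrite /frob_inner -mxtrace_tr trmx_mul trmxK. Qed.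

Lemma frob_innerDl X Y D : frob_inner (X + Y) D = frob_inner X D + frob_inner Y D.
Proof. by rewrite /frob_inner linearD /= mulmxDl mxtraceD. Qed.

Lemma frob_innerZl a X D : frob_inner (a *: X) D = a * frob_inner X D.
Proof. by rewrite /frob_inner linearZ /= -scalemxAl mxtraceZ. Qed.

Lemma frob_innerBl X Y D : frob_inner (X - Y) D = frob_inner X D - frob_inner Y D.
Proof. by rewrite -scaleN1r frob_innerDl frob_innerZl mulN1r. Qed.

Lemma frob_innerZr a X D : frob_inner D (a *: X) = a * frob_inner D X.
Proof. by rewrite /frob_inner -scalemxAr mxtraceZ. Qed.

Lemma frob_innerDr X Y D : frob_inner D (X + Y) = frob_inner D X + frob_inner D Y.
Proof. by rewrite /frob_inner mulmxDr mxtraceD. Qed.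

Lemma frob_innerBr X Y D : frob_inner D (X - Y) = frob_inner D X - frob_inner D Y.
Proof. by rewrite -scaleN1r frob_innerDr frob_innerZr mulN1r. Qed.

Lemma frob_inner0r X : frob_inner X 0 = 0.
Proof. by rewrite -(scale0r 0) frob_innerZr mul0r. Qed.

Lemma frob_inner_delta X i j : frob_inner X (delta_mx i j) = X i j.
Proof.
rewrite frob_innerE (bigD1 i) //= (bigD1 j) //= mxE !eqxx mulr1.
rewrite big1 ?addr0 => [|l /negPf lj]; last by rewrite mxE lj andbF mulr0.
rewrite big1 ?addr0 // => k /negPf ki.
by rewrite big1 // => l _; rewrite mxE ki mulr0.
Qed.

Lemma frob_inner_ge0 X : 0 <= frob_inner X X.
Proof.
rewrite frob_innerE; apply: sumr_ge0 => i _; apply: sumr_ge0 => j _.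
by rewrite -expr2 sqr_ge0.
Qed.

Lemma frob_inner_gt0 X : X != 0 -> 0 < frob_inner X X.
Proof.
move=> X0; rewrite lt_neqAle frob_inner_ge0 andbT; apply: contra X0.
move=> /eqP /esym; rewrite frob_innerE => /eqP.
rewrite psumr_eq0 => [/allP X0|i _]; last first.
  by apply: sumr_ge0 => j _; rewrite -expr2 sqr_ge0.
apply/eqP/matrixP => i j; rewrite mxE.
have := X0 i (mem_index_enum i); rewrite psumr_eq0 => [/allP|k _]; last first.
  by rewrite -expr2 sqr_ge0.
by move=> /(_ j (mem_index_enum j)); rewrite -expr2 sqrf_eq0 => /eqP.
Qed.

Lemma frob_inner_eq0 X : frob_inner X X = 0 -> X = 0.
Proof.
by move=> X0; apply/eqP/negP => /negP /frob_inner_gt0; rewrite X0 ltxx.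
Qed.

Lemma frob_norm_sq X : frob_norm X ^+ 2 = frob_inner X X.
Proof. by rewrite sqr_sqrtr // frob_inner_ge0. Qed.

Lemma frob_norm0 : frob_norm (0 : 'M[R]_(m, q)) = 0.
Proof. by rewrite /frob_norm frob_inner0r sqrtr0. Qed.

Lemma frob_norm_ge0 X : 0 <= frob_norm X.
Proof. exact: sqrtr_ge0. Qed.

(** Cauchy-Schwarz: subtract from X its projection on Y. *)
Lemma frob_inner_le X Y : frob_inner X Y <= frob_norm X * frob_norm Y.
Proof.
have [->|Y0] := eqVneq Y 0.
  by rewrite frob_inner0r mulr_ge0 ?frob_norm_ge0.
have yy := frob_inner_gt0 Y0.
have := frob_inner_ge0 (X - (frob_inner X Y / frob_inner Y Y) *: Y).
set t := _ / _; have tE : t * frob_inner Y Y = frob_inner X Y.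
  by rewrite divfK // gt_eqF.
rewrite frob_innerBl frob_innerZl !frob_innerBr !frob_innerZr tE.
rewrite [frob_inner Y X]frob_innerC => h.
have [|xy0] := leP (frob_inner X Y) 0.
  by move=> /le_trans; apply; rewrite mulr_ge0 ?frob_norm_ge0.
rewrite -ler_sqr ?nnegrE ?mulr_ge0 ?frob_norm_ge0 ?(ltW xy0) //.
rewrite exprMn !frob_norm_sq -tE.
have := mulr_ge0 (ltW yy) h; rewrite -tE; lra.
Qed.

Lemma frob_normZ a X : frob_norm (a *: X) = `|a| * frob_norm X.
Proof.
rewrite /frob_norm frob_innerZl frob_innerZr mulrA -expr2 sqrtrM ?sqr_ge0 //.
by rewrite sqrtr_sqr.
Qed.

Lemma frob_inner_norm_le X Y :
  `|frob_inner X Y| <= frob_norm X * frob_norm Y.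
Proof.
rewrite ler_norml frob_inner_le andbT lerNl -mulN1r -frob_innerZl.
by apply: (le_trans (frob_inner_le _ _)); rewrite frob_normZ normrN1 mul1r.
Qed.

Lemma frob_normD_le X Y : frob_norm (X + Y) <= frob_norm X + frob_norm Y.
Proof.
rewrite -ler_sqr ?nnegrE ?addr_ge0 ?frob_norm_ge0 // sqrrD !frob_norm_sq.
rewrite frob_innerDl !frob_innerDr [frob_inner Y X]frob_innerC.
have := frob_inner_le X Y; lra.
Qed.

Lemma frob_norm_gt0 X : X != 0 -> 0 < frob_norm X.
Proof. by move=> X0; rewrite sqrtr_gt0 frob_inner_gt0. Qed.

Lemma frob_inner_tr X Y :
  frob_inner X^T Y^T = frob_inner X Y.
Proof. by rewrite /frob_inner trmxK mxtrace_mulC -mxtrace_tr trmx_mul trmxK. Qed.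

End Frobenius.

Section FrobeniusProducts.
Context {R : realType}.

Lemma frob_inner_mull {m k q : nat} (A : 'M[R]_(m, k)) (X : 'M[R]_(k, q)) Y :
  frob_inner (A *m X) Y = frob_inner X (A^T *m Y).
Proof. by rewrite /frob_inner trmx_mul mulmxA. Qed.

Lemma frob_inner_rank1 {n p : nat} (w : 'cV[R]_n) (v : 'cV[R]_p) (E : 'M[R]_(n, p)) :
  frob_inner (w *m v^T) E = frob_inner w (E *m v).
Proof. by rewrite /frob_inner trmx_mul trmxK -mulmxA mxtrace_mulC mulmxA. Qed.

Lemma frob_norm_rank1 {n p : nat} (w : 'cV[R]_n) (v : 'cV[R]_p) :
  frob_inner v v = 1 -> frob_norm (w *m v^T) = frob_norm w.
Proof.
rewrite {1}/frob_inner trace_mx11 => v1.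
rewrite /frob_norm frob_inner_rank1 -mulmxA [v^T *m v]mx11_scalar v1.
by rewrite mulmx1.
Qed.

Lemma frob_inner_cols {n p : nat} (Z : 'M[R]_(n, p)) :
  frob_inner Z Z =
  \sum_j frob_inner (Z *m delta_mx j 0 : 'cV[R]_n) (Z *m delta_mx j 0).
Proof.
rewrite /frob_inner; apply: eq_bigr => j _.
by rewrite trace_mx11 -!colE !mxE; apply: eq_bigr => i _; rewrite !mxE.
Qed.

(** Testing the form at u + E u isolates twice the squared norm of E u. *)
Lemma sym_quadratic_form_eq0 {k : nat} (E : 'M[R]_k) : E^T = E ->
  (forall u : 'cV[R]_k, frob_inner u (E *m u) = 0) -> E = 0.
Proof.
move=> ET E0; apply: trmx_inj; rewrite trmx0; apply/row_matrixP => i.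
rewrite row0 -tr_col colE; apply: trmx_inj; rewrite trmxK trmx0.
set u : 'cV_k := delta_mx i 0.
have := E0 (u + E *m u); rewrite mulmxDr frob_innerDl !frob_innerDr !E0.
rewrite [frob_inner u _]frob_innerC frob_inner_mull ET => h.
by apply: frob_inner_eq0; lra.
Qed.

Lemma sym_part_tr {k : nat} (A : 'M[R]_k) : (sym_part A)^T = sym_part A.
Proof. by rewrite /sym_part linearZ /= linearD /= trmxK addrC. Qed.

Lemma sym_part_form {k : nat} (A : 'M[R]_k) (v : 'cV[R]_k) :
  frob_inner v (sym_part A *m v) = frob_inner v (A *m v).
Proof.
rewrite /sym_part -scalemxAl frob_innerZr mulmxDl frob_innerDr.
by rewrite [frob_inner v (A^T *m v)]frob_innerC frob_inner_mull trmxK; lra.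
Qed.

Lemma trace_sym_part {k : nat} (A B : 'M[R]_k) :
  B^T = B -> \tr (B *m sym_part A) = \tr (B *m A).
Proof.
move=> BT; rewrite /sym_part -scalemxAr mulmxDr mxtraceZ mxtraceD.
rewrite -[\tr (B *m A^T)]mxtrace_tr trmx_mul trmxK BT mxtrace_mulC.
lra.
Qed.

Lemma mxtrace_sym_partC {k : nat} (A B : 'M[R]_k) :
  \tr (A^T *m sym_part B) = \tr (sym_part A *m B).
Proof.
rewrite /sym_part -scalemxAr -scalemxAl !mxtraceZ mulmxDr mulmxDl !mxtraceD.
by rewrite -[\tr (A^T *m B^T)]mxtrace_tr trmx_mul !trmxK addrC mxtrace_mulC.
Qed.

End FrobeniusProducts.

(** * Differential calculus of matrix-valued maps *)

Section MatrixCalculus.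
Context {R : realType}.

(** A linear map out of a matrix space is automatically continuous: it is a
    finite combination of coordinate functions. *)
Lemma linear_mx_differentiable {m n : nat} {W : normedModType R}
    (l : {linear 'M[R]_(m, n) -> W}) (A : 'M[R]_(m, n)) : differentiable l A.
Proof.
have -> : (l : 'M[R]_(m, n) -> W) = \sum_(i < m) \sum_(j < n)
    (fun B : 'M[R]_(m, n) => (B i j : R^o) *: l (delta_mx i j)).
  apply/funext => B; rewrite fct_sumE [in LHS](matrix_sum_delta B) linear_sum.
  apply: eq_bigr => i _; rewrite fct_sumE linear_sum.
  by apply: eq_bigr => j _; rewrite linearZ.
apply: differentiable_sum => i; apply: differentiable_sum => j.
by apply: differentiableZl; exact: differentiable_coord.
Qed.

Lemma is_diff_linear_mx {m n : nat} {W : normedModType R}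
    (l : {linear 'M[R]_(m, n) -> W}) (A : 'M[R]_(m, n)) : is_diff A l l.
Proof.
apply: DiffDef; first exact: linear_mx_differentiable.
apply: diff_lin => B.
by apply: (differentiable_continuous); exact: linear_mx_differentiable.
Qed.

Context {V : normedModType R}.
Implicit Type x : V.

Lemma differentiable_mx {m n : nat} (F : V -> 'M[R]_(m, n)) x :
  (forall i j, differentiable (fun y => F y i j : R^o) x) ->
  differentiable F x.
Proof.
move=> dF.
have -> : F = \sum_(i < m) \sum_(j < n)
    (fun y : V => (F y i j : R^o) *: (delta_mx i j : 'M[R]_(m, n))).
  apply/funext => y; rewrite fct_sumE [in LHS](matrix_sum_delta (F y)).
  by apply: eq_bigr => i _; rewrite fct_sumE.
apply: differentiable_sum => i; apply: differentiable_sum => j.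
by apply: differentiableZl; exact: dF.
Qed.

Lemma is_diff_linear_comp {m n : nat} {W : normedModType R}
    (l : {linear 'M[R]_(m, n) -> W}) (F dF : V -> 'M[R]_(m, n)) x :
  is_diff x F dF -> is_diff x (fun y => l (F y)) (fun h => l (dF h)).
Proof.
move=> dFx.
exact: (is_diff_comp dFx (is_diff_linear_mx l (F x))).
Qed.

End MatrixCalculus.

Section MatrixProduct.
Context {R : realType} {m k n : nat}.

Lemma mulmx_is_bilinear :
  bilinear_for
    (GRing.Scale.Law.clone _ _ *:%R _) (GRing.Scale.Law.clone _ _ *:%R _)
    (@mulmx R m k n).
Proof.
split=> [B|A] a C D /=.
- by rewrite mulmxDl scalemxAl.
- by rewrite mulmxDr scalemxAr.
Qed.

HB.instance Definition _ := bilinear_isBilinear.Build R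
  'M[R]_(m, k) 'M[R]_(k, n) 'M[R]_(m, n) _ _ (@mulmx R m k n)
  mulmx_is_bilinear.

(** Differentiability is obtained first, entrywise, and continuity from it;
    continuity is then what the bilinear product rule asks for. *)
Lemma mulmx_continuous :
  continuous (fun q : 'M[R]_(m, k) * 'M[R]_(k, n) => q.1 *m q.2).
Proof.
move=> q; apply: differentiable_continuous; apply: differentiable_mx => i j.
have -> : (fun q : 'M[R]_(m, k) * 'M[R]_(k, n) => (q.1 *m q.2) i j : R^o) =
    \sum_(l < k) ((fun q : 'M[R]_(m, k) * 'M[R]_(k, n) => q.1 i l : R^o) *
      (fun q : 'M[R]_(m, k) * 'M[R]_(k, n) => q.2 l j : R^o)).
  by apply/funext => r; rewrite mxE fct_sumE.
apply: differentiable_sum => l; apply: differentiableM.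
- apply: (@differentiable_comp _ _ _ _ fst (fun B : 'M[R]_(m, k) => B i l : R^o)).
    by apply: linear_differentiable => ?; exact: cvg_fst.
  exact: differentiable_coord.
- apply: (@differentiable_comp _ _ _ _ snd (fun B : 'M[R]_(k, n) => B l j : R^o)).
    by apply: linear_differentiable => ?; exact: cvg_snd.
  exact: differentiable_coord.
Qed.

Lemma is_diff_mulmx {V : normedModType R} (F dF : V -> 'M[R]_(m, k))
    (G dG : V -> 'M[R]_(k, n)) (x : V) :
  is_diff x F dF -> is_diff x G dG ->
  is_diff x (fun y => F y *m G y) (fun h => dF h *m G x + F x *m dG h).
Proof.
move=> dFx dGx.
have dFG := is_diff_pair dFx dGx.
have dmul : is_diff (F x, G x)
    (fun q : 'M[R]_(m, k) * 'M[R]_(k, n) => q.1 *m q.2)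
    (fun q => F x *m q.2 + q.1 *m G x).
  apply: DiffDef; first by apply: differentiable_bilin; exact: mulmx_continuous.
  by rewrite diff_bilin //; exact: mulmx_continuous.
apply: (is_diff_eq (is_diff_comp dFG dmul)).
by apply/funext => h /=; rewrite addrC.
Qed.

End MatrixProduct.

Section DerivedRules.
Context {R : realType} {V : normedModType R}.
Implicit Type x : V.

Lemma is_diff_trace {k : nat} (F dF : V -> 'M[R]_k) x :
  is_diff x F dF -> is_diff x (fun y => \tr (F y) : R^o) (fun h => \tr (dF h)).
Proof. exact: (is_diff_linear_comp (@mxtrace R k : {linear _ -> R^o})). Qed.

Lemma is_diff_frob_inner {m q : nat}
    (F dF G dG : V -> 'M[R]_(m, q)) x :
  is_diff x F dF -> is_diff x G dG ->
  is_diff x (fun y => frob_inner (F y) (G y) : R^o)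
    (fun h => \tr ((dF h)^T *m G x + (F x)^T *m dG h)).
Proof.
move=> dFx dGx.
exact: (is_diff_trace (is_diff_mulmx (is_diff_linear_comp trmx dFx) dGx)).
Qed.

Lemma is_diff_sym_part {k : nat} (F dF : V -> 'M[R]_k) x :
  is_diff x F dF ->
  is_diff x (fun y => sym_part (F y)) (fun h => sym_part (dF h)).
Proof.
move=> dFx.
exact: (is_diffZ 2^-1 (is_diffD dFx (is_diff_linear_comp trmx dFx))).
Qed.

Lemma is_diff_sq {k : nat} (F dF : V -> 'M[R]_k) x (c : R) :
  is_diff x F dF ->
  is_diff x (fun y => F y *m F y - c%:M) (fun h => dF h *m F x + F x *m dF h).
Proof.
move=> dFx.
apply: (is_diff_eq (is_diffB (is_diff_mulmx dFx dFx) (is_diff_cst c%:M x))).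
by apply/funext => h /=; rewrite !fctE /= subr0.
Qed.

End DerivedRules.

Section Gradient.
Context {R : realType} {n p : nat}.
Implicit Types (g : 'M[R]_(n, p) -> R^o) (X D : 'M[R]_(n, p)).

Lemma diff_frob_grad g X D : 'd g X D = frob_inner (grad g X) D.
Proof.
rewrite [in LHS](matrix_sum_delta D) frob_innerE linear_sum.
apply: eq_bigr => i _; rewrite linear_sum; apply: eq_bigr => j _.
by rewrite linearZ /= mxE mulrC.
Qed.

Lemma is_diff_grad g X (H : 'M[R]_(n, p)) :
  is_diff X g (fun D => frob_inner H D) -> grad g X = H.
Proof.
by move=> dg; apply/matrixP => i j; rewrite mxE diff_val frob_inner_delta.
Qed.

End Gradient.

Section LipschitzGradient.
Context {R : realType} {n p : nat}.
Variables (f : 'M[R]_(n, p) -> R^o) (L : R).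
Hypothesis f_lip : lipschitz_grad L f.
Implicit Types X D : 'M[R]_(n, p).

(** The Hessian form along D is the directional derivative of
    Y |-> <D, grad f Y>, whose difference quotients are at most L |D|^2. *)
Lemma frob_hess_le X D : differentiable (grad f) X ->
  frob_inner D (hess f X D) <= L * frob_norm D ^+ 2.
Proof.
move=> dg.
have dk : is_diff X (fun Y => frob_inner D (grad f Y) : R^o)
    (fun E => frob_inner D (hess f X E)).
  exact: (is_diff_trace (is_diff_linear_comp (mulmx D^T) (differentiableP dg))).
have dX : differentiable (fun Y => frob_inner D (grad f Y) : R^o) X.
  exact: ex_diff.
have -> : frob_inner D (hess f X D)
    = 'D_D (fun Y => frob_inner D (grad f Y) : R^o) X.
  by rewrite deriveE // diff_val.
apply: limr_le; first exact: diff_derivable.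
near=> t.
have t0 : t != 0 by near: t; exact: nbhs_dnbhs_neq.
apply: (le_trans (ler_norm _)).
rewrite normrM normfV ler_pdivrMl ?normr_gt0 //.
have -> : frob_inner D (grad f (t *: D + X)) - frob_inner D (grad f X)
    = frob_inner D (grad f (t *: D + X) - grad f X).
  by rewrite frob_innerBr.
apply: (le_trans (frob_inner_norm_le _ _)).
have := f_lip (t *: D + X) X; rewrite addrK frob_normZ => h.
have := ler_wpM2l (frob_norm_ge0 D) h; rewrite expr2; lra.
Unshelve. all: by end_near. Qed.

Lemma frob_grad_le X :
  frob_norm (grad f X) <= frob_norm (grad f 0) + L * frob_norm X.
Proof.
have -> : grad f X = grad f 0 + (grad f X - grad f 0) by rewrite addrC subrK.
apply: (le_trans (frob_normD_le _ _)).
by rewrite lerD2l (le_trans (f_lip _ _)) // subr0.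
Qed.

Lemma lipschitz_grad_ge0 : (0 < n)%N -> (0 < p)%N -> 0 <= L.
Proof.
move=> n0 p0; pose E : 'M[R]_(n, p) := const_mx 1.
have E0 : E != 0.
  apply/eqP => /matrixP /(_ (Ordinal n0) (Ordinal p0)).
  by rewrite !mxE => /eqP; rewrite oner_eq0.
have := le_trans (frob_norm_ge0 _) (f_lip E 0).
by rewrite subr0 pmulr_lge0 // frob_norm_gt0.
Qed.

End LipschitzGradient.

(** * Extremal eigenvectors and singular values *)

Section Rayleigh.
Context {R : realType}.

Lemma quadratic_form_continuous {m q : nat} (A : 'M[R]_q) :
  continuous (fun X : 'M[R]_(m, q) => frob_inner X (X *m A) : R^o).
Proof.
move=> X; apply: differentiable_continuous.
have h := is_diff_frob_inner (is_diff_id X)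
  (is_diff_linear_comp (mulmxr A) (is_diff_id X)).
exact: ex_diff.
Qed.

(** Stated on row vectors, where closed bounded sets are compact. *)
Lemma unit_sphere_compact {k : nat} :
  compact [set r : 'rV[R]_k | frob_inner r r = 1].
Proof.
apply: bounded_closed_compact.
  exists 1; split=> [|C C1 r /= r1]; first by rewrite num_real.
  apply: (le_trans _ (ltW C1)).
  rewrite [leLHS]/Num.Def.normr /= mx_normrE; apply: bigmax_le => // -[i j] _ /=.
  rewrite -(@expr_le1 _ 2) // real_normK ?num_real // -r1 frob_innerE.
  rewrite (bigD1 i) //= (bigD1 j) //= expr2 -addrA lerDl addr_ge0 //.
    by apply: sumr_ge0 => l _; rewrite -expr2 sqr_ge0.
  by apply: sumr_ge0 => l _; apply: sumr_ge0 => l' _; rewrite -expr2 sqr_ge0.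
have -> : [set r : 'rV[R]_k | frob_inner r r = 1]
    = (fun r => frob_inner r (r *m 1%:M) : R^o) @^-1` [set 1].
  by apply/seteqP; split=> r /=; rewrite mulmx1.
apply: closed_comp => [r _|]; first exact: quadratic_form_continuous.
exact: closed_eq.
Qed.

(** The minimizer v of the Rayleigh quotient is an eigenvector: with
    e = A v - lam v, the form of A - lam is nonnegative and vanishes at v, so
    0 <= 2 t |e|^2 + t^2 b for every t, where b is its value at e; this forces
    e = 0. *)
Lemma min_eigenvector {k : nat} (A : 'M[R]_k) : (0 < k)%N -> A^T = A ->
  exists (lam : R) (v : 'cV[R]_k),
    [/\ frob_inner v v = 1, A *m v = lam *: v &
      forall u : 'cV[R]_k, lam * frob_inner u u <= frob_inner u (A *m u)].
Proof.
move=> k0 AT.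
have sphere0 : [set r : 'rV[R]_k | frob_inner r r = 1] !=set0.
  exists (delta_mx 0 (Ordinal k0)); rewrite /= frob_inner_delta mxE !eqxx //.
have [c /set_mem /= c1 cmin] := EVT_min_rV sphere0 unit_sphere_compact
  (continuous_subspaceT (quadratic_form_continuous (A := A))).
set lam := frob_inner c (c *m A) in cmin.
pose v := c^T; exists lam, v.
have v1 : frob_inner v v = 1 by rewrite frob_inner_tr.
have Av : frob_inner v (A *m v) = lam.
  by rewrite /v -{1}AT -trmx_mul frob_inner_tr.
have vmin (u : 'cV[R]_k) : lam * frob_inner u u <= frob_inner u (A *m u).
  have [->|u0] := eqVneq u 0.
    by rewrite mulmx0 frob_inner0r mulr0.
  have nu := frob_norm_gt0 u0.
  have := cmin ((frob_norm u)^-1 *: u^T).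
  rewrite inE /= -!scalemxAl !frob_innerZl !frob_innerZr.
  have -> : frob_inner u^T (u^T *m A) = frob_inner u (A *m u).
    by rewrite -{1}AT -trmx_mul frob_inner_tr.
  rewrite frob_inner_tr -frob_norm_sq mulrA -expr2 -exprMn mulVf ?gt_eqF //.
  rewrite expr1n mulrA -expr2 exprVn => /(_ erefl).
  by rewrite ler_pdivlMl ?exprn_gt0 // mulrC.
split=> //.
pose e := A *m v - lam *: v.
have e0 : frob_inner e e = 0; last first.
  by apply/eqP; rewrite -subr_eq0; apply/eqP; exact: frob_inner_eq0.
pose a := frob_inner e e; pose b := frob_inner e (A *m e) - lam * frob_inner e e.
have b0 : 0 <= b by rewrite subr_ge0.
have a0 : 0 <= a by exact: frob_inner_ge0.
have var t : 0 <= 2 * t * a + t ^+ 2 * b.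
  have := vmin (v + t *: e); rewrite mulmxDr -scalemxAr !frob_innerDl !frob_innerZl.
  rewrite !frob_innerDr !frob_innerZr v1 Av.
  have vAe : frob_inner v (A *m e) = frob_inner e (A *m v).
    by rewrite frob_innerC frob_inner_mull AT.
  have ea : frob_inner e (A *m v) - lam * frob_inner e v = a.
    by rewrite /a [in RHS]/e frob_innerBr frob_innerZr.
  rewrite vAe [frob_inner v e]frob_innerC /b -ea; nra.
(* b may vanish, hence b + 1 in the nearly optimal value of t. *)
have := var (- (a / (b + 1))).
have b1 : 0 < b + 1 by lra.
have -> : 2 * - (a / (b + 1)) * a + (- (a / (b + 1))) ^+ 2 * b
   = - (a ^+ 2 * ((b + 2) / (b + 1) ^+ 2)).
  by field; rewrite gt_eqF.
rewrite oppr_ge0 pmulr_lle0 ?divr_gt0 ?exprn_gt0 //; last by lra.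
by move=> h; apply/eqP; rewrite -sqrf_eq0 eq_le h sqr_ge0.
Qed.

(** With 1 as the smallest eigenvalue and c <= 1, the largest one is 1 too, and
    the quadratic form of S - 1 vanishes. *)
Lemma sym_eq1_or_small_eigenvalue {k : nat} (S : 'M[R]_k) (c : R) :
  (0 < k)%N -> S^T = S -> c <= 1 ->
  (forall s (v : 'cV[R]_k), frob_inner v v = 1 -> S *m v = s *: v ->
     s = 1 \/ s <= c) ->
  S = 1%:M \/ exists s (v : 'cV[R]_k),
    [/\ frob_inner v v = 1, S *m v = s *: v & s <= c].
Proof.
move=> k0 ST c1 spec.
have [s [v [v1 Sv s_le]]] := min_eigenvector k0 ST.
have [s1|sc] := spec _ _ v1 Sv; last by right; exists s, v.
left; have NST : (- S)^T = - S by rewrite linearN /= ST.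
have [t [w [w1 Sw t_le]]] := min_eigenvector k0 NST.
have {}Sw : S *m w = (- t) *: w by rewrite scaleNr -Sw mulNmx opprK.
have t1 : - t <= 1 by case: (spec _ _ w1 Sw) => [->//|/le_trans]; exact.
apply/eqP; rewrite -subr_eq0; apply/eqP; apply: sym_quadratic_form_eq0 => [|u].
  by rewrite linearB /= tr_scalar_mx ST.
rewrite mulmxBl mul1mx frob_innerBr.
have := t_le u; have := s_le u; rewrite s1 mulNmx -scaleN1r frob_innerZr.
have : 0 <= (1 + t) * frob_inner u u by rewrite mulr_ge0 ?frob_inner_ge0 //; lra.
lra.
Qed.

End Rayleigh.

Section SingularValues.
Context {R : realType} {k : nat}.
Variable M : 'M[R]_k.
Hypotheses (k_gt0 : (0 < k)%N) (M_posdef : symmetric_posdef M).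

Lemma posdef_frob_inner_gt0 (v : 'cV[R]_k) : v != 0 -> 0 < frob_inner v (M *m v).
Proof.
by case: M_posdef => _ Mpos /Mpos; rewrite /frob_inner mulmxA trace_mx11.
Qed.

(** If M^2 v = s^2 v, then u = M v + s v satisfies M u = s u, and it is nonzero
    because - s <= 0 is not an eigenvalue of the positive definite M. *)
Lemma singular_value_eigenvector s : singular_values M s ->
  exists2 u : 'cV[R]_k, u != 0 & M *m u = s *: u.
Proof.
case: M_posdef => MT _ [s0 /eigenvalueP[r rM r0]].
pose v := r^T.
have v0 : v != 0 by rewrite trmx_eq0.
have MMv : M *m (M *m v) = s ^+ 2 *: v.
  by apply: trmx_inj; rewrite linearZ /= !trmx_mul MT trmxK -mulmxA -rM MT.
exists (M *m v + s *: v); last first.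
  by rewrite mulmxDr MMv -scalemxAr scalerDr scalerA addrC.
apply/eqP => u0; have := posdef_frob_inner_gt0 v0.
have -> : M *m v = - s *: v by apply/eqP; rewrite scaleNr -addr_eq0 u0.
rewrite frob_innerZr mulNr oppr_gt0 ltNge mulr_ge0 //.
exact: frob_inner_ge0.
Qed.

(** By the previous lemma the singular values are eigenvalues of M, so the
    smallest eigenvalue bounds them below and is attained. The largest
    eigenvalue only serves to bound them above, so that their supremum is
    meaningful. *)
Lemma sigma_min_cond_number :
  [/\ 0 < sigma_min M, 1 <= cond_number M &
    forall u : 'cV[R]_k, sigma_min M * frob_inner u u <= frob_inner u (M *m u)].
Proof.
have MT : M^T = M by case: M_posdef.
have [lam [v [v1 Mv lam_le]]] := min_eigenvector k_gt0 MT.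
have v0 : v != 0.
  apply/eqP => v0; move/eqP: v1.
  by rewrite v0 frob_inner0r eq_sym oner_eq0.
have lam_gt0 : 0 < lam.
  by have := posdef_frob_inner_gt0 v0; rewrite Mv frob_innerZr v1 mulr1.
have lamS : singular_values M lam.
  split; first exact: ltW.
  apply/eigenvalueP; exists v^T; last by rewrite trmx_eq0.
  apply: trmx_inj; rewrite linearZ /= !trmx_mul !trmxK -mulmxA MT Mv.
  by rewrite -scalemxAr Mv scalerA.
have lamlb : lbound (singular_values M) lam.
  move=> s /singular_value_eigenvector [u u0 Mu].
  by have := lam_le u; rewrite Mu frob_innerZr ler_pM2r // frob_inner_gt0.
have NMT : (- M)^T = - M by rewrite linearN /= MT.
have [mu [w [_ _ mu_le]]] := min_eigenvector k_gt0 NMT.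
have muub : ubound (singular_values M) (- mu).
  move=> s /singular_value_eigenvector [u u0 Mu].
  have := mu_le u; rewrite mulNmx Mu -scaleNr frob_innerZr.
  by rewrite ler_pM2r ?frob_inner_gt0 // lerNr.
have minE : sigma_min M = lam.
  apply/eqP; rewrite eq_le; apply/andP; split.
    by apply: ge_inf => //; exists lam.
  by apply: lb_le_inf => //; exists lam.
rewrite minE; split=> //.
rewrite /cond_number minE ler_pdivlMr // mul1r.
by apply: ub_le_sup => //; exists (- mu).
Qed.

End SingularValues.

(** * Gradient and Hessian of the penalty function *)

Section Penalty.
Context {R : realType} {n p : nat}.
Variables (f : 'M[R]_(n, p) -> R^o) (M : 'M[R]_n) (beta : R).
Implicit Types X D : 'M[R]_(n, p).

Definition gram X : 'M[R]_p := X^T *m M *m X.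

Definition dgram X D : 'M[R]_p := D^T *m M *m X + X^T *m M *m D.

Definition ddissolving X D : 'M[R]_(n, p) :=
  D *m ((3 / 2)%:M - 2^-1 *: gram X) - X *m (2^-1 *: dgram X D).

(** The gradient of the penalty function for the Frobenius inner product. *)
Definition penalty_grad X : 'M[R]_(n, p) :=
  let G := grad f (dissolving M X) in
  G *m ((3 / 2)%:M - 2^-1 *: gram X) - M *m X *m sym_part (X^T *m G)
  + beta *: (M *m X *m (gram X *m gram X - 1%:M)).

(** The derivative of [penalty_grad] at X in the direction D. *)
Definition penalty_hess X D : 'M[R]_(n, p) :=
  let G := grad f (dissolving M X) in
  let H := hess f (dissolving M X) (ddissolving X D) in
  H *m ((3 / 2)%:M - 2^-1 *: gram X) - G *m (2^-1 *: dgram X D)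
  - (M *m D *m sym_part (X^T *m G)
     + M *m X *m sym_part (D^T *m G + X^T *m H))
  + beta *: (M *m D *m (gram X *m gram X - 1%:M)
             + M *m X *m (dgram X D *m gram X + gram X *m dgram X D)).

Lemma is_diff_gram X : is_diff X gram (dgram X).
Proof.
have h : is_diff X (fun Y : 'M[R]_(n, p) => Y^T *m M) (fun D => D^T *m M).
  exact: (is_diff_linear_comp (mulmxr M) (is_diff_linear_comp trmx (is_diff_id X))).
exact: (is_diff_mulmx h (is_diff_id X)).
Qed.

Lemma is_diff_shrink X :
  is_diff X (fun Y => (3 / 2)%:M - 2^-1 *: gram Y) (fun D => - (2^-1 *: dgram X D)).
Proof.
apply: (is_diff_eq (is_diffB (is_diff_cst (3 / 2)%:M X)
  (is_diffZ 2^-1 (is_diff_gram X)))).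
by apply/funext => D /=; rewrite !fctE /= add0r.
Qed.

Lemma is_diff_dissolving X : is_diff X (dissolving M) (ddissolving X).
Proof.
apply: (is_diff_eq (is_diff_mulmx (is_diff_id X) (is_diff_shrink X))).
by apply/funext => D; rewrite mulmxN.
Qed.

Lemma gram_tr X : M^T = M -> (gram X)^T = gram X.
Proof. by move=> MT; rewrite /gram !trmx_mul trmxK MT mulmxA. Qed.

End Penalty.

Section PenaltyDerivatives.
Context {R : realType} {n p : nat}.
Variables (f : 'M[R]_(n, p) -> R^o) (M : 'M[R]_n) (beta : R).
Implicit Types X D : 'M[R]_(n, p).

Lemma is_diff_penalty_grad X :
  differentiable (grad f) (dissolving M X) ->
  is_diff X (penalty_grad f M beta) (penalty_hess f M beta X).
Proof.
move=> df.
have dG := is_diff_comp (is_diff_dissolving M X) (differentiableP df).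
have dT := is_diff_shrink M X.
have dMX := is_diff_linear_comp (mulmx M) (is_diff_id X).
have dX := is_diff_linear_comp (@trmx R n p) (is_diff_id X).
have dsym := is_diff_sym_part (is_diff_mulmx dX dG).
have dsq := is_diff_sq 1 (is_diff_gram M X).
have d1 := is_diff_mulmx dG dT.
have d2 := is_diff_mulmx dMX dsym.
have d3 := is_diffZ beta (is_diff_mulmx dMX dsq).
apply: (is_diff_eq (is_diffD (is_diffB d1 d2) d3)).
by apply/funext => D /=; rewrite /penalty_hess -mulmxN.
Qed.

Hypothesis MT : M^T = M.

Lemma dgram_sym_part X D : 2^-1 *: dgram M X D = sym_part (X^T *m M *m D).
Proof.
by rewrite /sym_part /dgram !trmx_mul trmxK MT addrC mulmxA.
Qed.

(** The contribution of f is moved onto D by the self-adjointness of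
    U |-> sym U for the trace pairing; that of the penalty by the cyclicity of
    the trace, which collapses the noncommutative derivative of the cubic
    polynomial to 3 tr ((S^2 - 1) dS). *)
Lemma is_diff_penalty X :
  differentiable f (dissolving M X) ->
  is_diff X (penalty f M beta)
    (fun D => frob_inner (penalty_grad f M beta X) D).
Proof.
move=> df.
have dfA := is_diff_comp (is_diff_dissolving M X) (differentiableP df).
have dS := is_diff_gram M X.
have dtr := is_diff_trace (is_diff_mulmx dS (is_diff_sq 3 dS)).
apply: (is_diff_eq (is_diffD dfA (is_diffZ (beta / 6) dtr))).
apply/funext => D; rewrite fctE /= diff_frob_grad.
set G := grad f _; rewrite /penalty_grad -/G /ddissolving dgram_sym_part.
set S := gram M X; set U := X^T *m M *m D.
set T := _ - 2^-1 *: S.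
have ST : S^T = S by exact: gram_tr.
have TT : T^T = T by rewrite /T linearB /= tr_scalar_mx linearZ /= ST.
have fE : frob_inner G (D *m T - X *m sym_part U) =
    frob_inner (G *m T - M *m X *m sym_part (X^T *m G)) D.
  rewrite /frob_inner [(_ - _)^T]linearB /= !trmx_mul TT MT sym_part_tr.
  rewrite mulmxBr mulmxBl.
  rewrite ![\tr (_ - _)]linearB /=; congr (_ - _).
    by rewrite mulmxA mxtrace_mulC mulmxA.
  have -> : G^T *m (X *m sym_part U) = (X^T *m G)^T *m sym_part U.
    by rewrite trmx_mul trmxK mulmxA.
  by rewrite mxtrace_sym_partC /U !mulmxA.
rewrite fE [RHS]frob_innerDl frob_innerZl; congr (_ + _).
have dE : dgram M X D = 2 *: sym_part U.
  by rewrite -dgram_sym_part scalerA divff ?scale1r // pnatr_eq0.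
set V := sym_part U in dE *.
transitivity (beta / 6 * \tr (dgram M X D *m (S *m S - 3%:M)
  + S *m (dgram M X D *m S + S *m dgram M X D))) => //.
rewrite dE.
have sqT : (S *m S - 1%:M)^T = S *m S - 1%:M.
  by rewrite linearB /= trmx_mul ST tr_scalar_mx.
have -> : frob_inner (M *m X *m (S *m S - 1%:M)) D
    = \tr ((S *m S - 1%:M) *m V).
  by rewrite /frob_inner (trace_sym_part U sqT) !trmx_mul sqT MT /U !mulmxA.
move: V {dE} => V.
rewrite -!scalemxAl -!scalemxAr -scalerDr -scalemxAr -scalerDr mxtraceZ.
rewrite mulmxBr mulmxBl mulmxDr mul_mx_scalar mul1mx.
rewrite !mxtraceD !raddfN /= mxtraceZ.
rewrite [\tr (V *m _)]mxtrace_mulC [\tr (S *m (V *m S))]mxtrace_mulC.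
rewrite -[_ *m S *m S]mulmxA -?mulmxA [\tr (V *m _)]mxtrace_mulC -?mulmxA.
lra.
Qed.

Lemma penalty_has_hessian X :
  (forall Y, differentiable f Y) -> (forall Y, has_hessian f Y) ->
  [/\ grad (penalty f M beta) = penalty_grad f M beta,
      has_hessian (penalty f M beta) X &
      hess (penalty f M beta) X = penalty_hess f M beta X :> (_ -> _)].
Proof.
move=> df d2f.
have gradE : grad (penalty f M beta) = penalty_grad f M beta.
  by apply/funext => Y; apply: is_diff_grad; exact: is_diff_penalty.
have [_ dg] := d2f (dissolving M X).
have dh := is_diff_penalty_grad dg.
split=> //.
  split; last by rewrite gradE; exact: ex_diff.
  apply: (@filterE _ _ (nbhs_filter X)) => Y.
  by have ? := is_diff_penalty (df (dissolving M Y)); exact: ex_diff.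
by rewrite /hess gradE diff_val.
Qed.

End PenaltyDerivatives.

(** * The spectrum of the Gram matrix at a stationary point *)

Section SpectrumBounds.
Context {R : realType} {k : nat}.
Variables (S : 'M[R]_k) (s : R).
Hypotheses (ST : S^T = S)
  (S_ge0 : forall u : 'cV[R]_k, 0 <= frob_inner u (S *m u))
  (S_le : forall u : 'cV[R]_k, frob_inner u (S *m u) <= s * frob_inner u u).
Implicit Type u : 'cV[R]_k.

Let form_sq u : frob_inner u (S *m (S *m u)) = frob_inner (S *m u) (S *m u).
Proof. by rewrite [RHS]frob_inner_mull ST. Qed.

(** The vector (3/2 - S/2) u, whose S-form is the squared M-norm of A(X) u when S
    is the Gram matrix of X. *)
Let shrink u : 'cV[R]_k := (3 / 2) *: u - 2^-1 *: (S *m u).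

Let shrink_form u : frob_inner (shrink u) (S *m shrink u) =
  (9 * frob_inner u (S *m u) - 6 * frob_inner (S *m u) (S *m u)
   + frob_inner (S *m u) (S *m (S *m u))) / 4.
Proof.
rewrite /shrink mulmxBr -!scalemxAr !frob_innerBl !frob_innerBr.
rewrite !frob_innerZl !frob_innerZr.
rewrite form_sq; lra.
Qed.

(** 1 - S (3/2 - S/2)^2 = (1 - S) (4 - S) (1 - S) / 4. *)
Lemma shrink_form_le1 u : s <= 4 ->
  frob_inner (shrink u) (S *m shrink u) <= frob_inner u u.
Proof.
move=> s4; rewrite shrink_form.
have := S_le (u - S *m u).
have bb := frob_inner_ge0 (u - S *m u).
have : s * frob_inner (u - S *m u) (u - S *m u)
   <= 4 * frob_inner (u - S *m u) (u - S *m u) by rewrite ler_wpM2r.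
rewrite mulmxBr !frob_innerBl !frob_innerBr.
rewrite [frob_inner (S *m u) u]frob_innerC.
rewrite form_sq; lra.
Qed.

(** The form of S is at most s times the squared norm of (3/2 - S/2) u. That
    norm is bounded with S^2 <= s S, which follows from
    s S (s - S) = S (s - S) S + (s - S) S (s - S). *)
Lemma shrink_form_le u : 4 <= s ->
  frob_inner (shrink u) (S *m shrink u) <= s * (1 + s) ^+ 2 / 4 * frob_inner u u.
Proof.
move=> s4; have s0 : 0 < s by lra.
set a1 := frob_inner u (S *m u); set a2 := frob_inner (S *m u) (S *m u).
set a0 := frob_inner u u.
have a20 : a2 <= s * a1.
  have h1 := S_le (S *m u); have := S_ge0 (s *: u - S *m u).
  rewrite mulmxBr -scalemxAr !frob_innerBl !frob_innerBr !frob_innerZl !frob_innerZr.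
  rewrite form_sq -/a1 -/a2 => h2.
  have : s * a2 <= s * (s * a1) by rewrite -/a2 in h1; lra.
  by rewrite ler_pM2l.
have a1le : a1 <= s * a0 := S_le u.
have a1ge : 0 <= a1 := S_ge0 u.
have a0ge : 0 <= a0 := frob_inner_ge0 u.
apply: (le_trans (S_le _)).
have -> : frob_inner (shrink u) (shrink u) = (9 * a0 - 6 * a1 + a2) / 4.
  rewrite /shrink !frob_innerBl !frob_innerBr !frob_innerZl !frob_innerZr.
  rewrite [frob_inner (S *m u) u]frob_innerC -/a0 -/a1 -/a2; lra.
rewrite -!mulrA ler_pM2l //.
have : s * a1 <= s * (s * a0) by rewrite ler_pM2l.
have : 4 * a0 <= s * a0 by rewrite ler_wpM2r.
by lra.
Qed.

End SpectrumBounds.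

Section StationaryEigenpair.
Context {R : realType} {n p : nat}.
Variables (f : 'M[R]_(n, p) -> R^o) (M : 'M[R]_n) (beta : R) (X : 'M[R]_(n, p)).
Hypotheses (MT : M^T = M) (X_crit : penalty_grad f M beta X = 0).
Let S := gram M X.
Let G := grad f (dissolving M X).

Lemma eigen_sq (s : R) (v : 'cV[R]_p) (c : R) : S *m v = s *: v ->
  (S *m S - c%:M) *m v = (s ^+ 2 - c) *: v.
Proof.
move=> Sv; rewrite mulmxBl mul_scalar_mx -mulmxA Sv -scalemxAr Sv scalerA.
by rewrite scalerBl.
Qed.

Lemma eigen_shrink (s : R) (v : 'cV[R]_p) : S *m v = s *: v ->
  ((3 / 2)%:M - 2^-1 *: S) *m v = ((3 - s) / 2) *: v.
Proof.
move=> Sv; rewrite mulmxBl mul_scalar_mx -scalemxAl Sv scalerA -scalerBl.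
by congr (_ *: _); lra.
Qed.

Lemma gram_form (u v : 'cV[R]_p) :
  frob_inner (X *m u) (M *m (X *m v)) = frob_inner u (S *m v).
Proof. by rewrite frob_inner_mull /S /gram !mulmxA. Qed.

(** This is the equation <X v, (grad h X) v> = 0. The two terms in G contribute
    ((3 - s) / 2 - s) <Xv, Gv>, and the penalty beta s (s^2 - 1), all divisible
    by 1 - s. *)
Lemma stationary_eigenpair (s : R) (v : 'cV[R]_p) :
  frob_inner v v = 1 -> S *m v = s *: v ->
  (1 - s) * (3 / 2 * frob_inner (X *m v) (G *m v) - beta * s * (1 + s)) = 0.
Proof.
move=> v1 Sv.
have SE y : frob_inner v (S *m y) = s * frob_inner v y.
  by rewrite frob_innerC frob_inner_mull gram_tr // Sv frob_innerZr frob_innerC.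
have : frob_inner (X *m v) (penalty_grad f M beta X *m v) = 0.
  by rewrite X_crit mul0mx frob_inner0r.
rewrite /penalty_grad -/S -/G mulmxDl mulmxBl -scalemxAl.
rewrite -!(mulmxA _ _ v) (eigen_shrink Sv) (eigen_sq _ Sv).
rewrite -!(mulmxA M) frob_innerDr frob_innerBr -!scalemxAr !frob_innerZr.
rewrite !gram_form SE Sv frob_innerZr v1 sym_part_form.
rewrite -mulmxA -frob_inner_mull; lra.
Qed.

End StationaryEigenpair.

Section StationarySpectrum.
Context {R : realType} {n p : nat}.
Variables (f : 'M[R]_(n, p) -> R^o) (M : 'M[R]_n) (beta : R) (X : 'M[R]_(n, p)).
Variables (L m : R).
Hypotheses (p_gt0 : (0 < p)%N) (MT : M^T = M) (beta_gt0 : 0 < beta)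
  (m_gt0 : 0 < m) (L_ge0 : 0 <= L) (f_lip : lipschitz_grad L f)
  (m_le : forall u : 'cV[R]_n, m * frob_inner u u <= frob_inner u (M *m u))
  (beta_large : 12 * (3 * p.+1%:R * L + Num.sqrt m * frob_norm (grad f 0))
    <= beta * m)
  (X_crit : penalty_grad f M beta X = 0).
Let S := gram M X.
Let G := grad f (dissolving M X).
Let mu := Num.sqrt m.
Let K0 := mu * frob_norm (grad f 0).

Lemma gram_form_ge (u : 'cV[R]_p) :
  m * frob_inner (X *m u) (X *m u) <= frob_inner u (S *m u).
Proof. by rewrite -gram_form. Qed.

Lemma gram_form_ge0 (u : 'cV[R]_p) : 0 <= frob_inner u (S *m u).
Proof.
by apply: le_trans (gram_form_ge u); rewrite mulr_ge0 ?frob_inner_ge0 ?ltW.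
Qed.

(** Column by column: m |A(X) e|^2 <= <A(X) e, M A(X) e>, which is the form of
    S at (3/2 - S/2) e. *)
Lemma dissolving_norm_le (C : R) : 0 <= C ->
  (forall u : 'cV[R]_p, let y := (3 / 2) *: u - 2^-1 *: (S *m u) in
     frob_inner y (S *m y) <= C ^+ 2 * frob_inner u u) ->
  mu * frob_norm (dissolving M X) <= p.+1%:R * C.
Proof.
move=> C0 formC.
have mu0 : 0 <= mu by exact: sqrtr_ge0.
rewrite -ler_sqr ?nnegrE ?mulr_ge0 ?frob_norm_ge0 // exprMn frob_norm_sq.
rewrite sqr_sqrtr ?(ltW m_gt0) // frob_inner_cols mulr_sumr.
apply: (@le_trans _ _ (\sum_(j < p) C ^+ 2)).
  apply: ler_sum => j _.
  set e : 'cV[R]_p := delta_mx j 0.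
  have e1 : frob_inner e e = 1 by rewrite frob_inner_delta mxE !eqxx.
  have -> : dissolving M X *m e = X *m ((3 / 2) *: e - 2^-1 *: (S *m e)).
    by rewrite /dissolving -mulmxA mulmxBl mul_scalar_mx -scalemxAl.
  apply: (le_trans (gram_form_ge _)).
  by apply: (le_trans (formC e)); rewrite e1 mulr1.
rewrite sumr_const card_ord exprMn -[C ^+ 2 *+ _]mulr_natl ler_wpM2r ?sqr_ge0 //.
by rewrite -natrX ler_nat; apply: (leq_trans (leqnSn p)); rewrite expnS expn1 leq_pmulr.
Qed.

(** The eigenpair identity read as an estimate, with <Xv, Gv> bounded by
    |Xv| |G| and all norms rescaled by sqrt m. *)
Lemma stationary_eigenvalue_bound (C s : R) (v : 'cV[R]_p) : 0 <= C ->
  (forall u : 'cV[R]_p, let y := (3 / 2) *: u - 2^-1 *: (S *m u) in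
     frob_inner y (S *m y) <= C ^+ 2 * frob_inner u u) ->
  frob_inner v v = 1 -> S *m v = s *: v -> s != 1 -> 0 < s ->
  beta * m * (Num.sqrt s * (1 + s)) <= 3 / 2 * (K0 + p.+1%:R * L * C).
Proof.
move=> C0 formC v1 Sv s1 s0.
have mu0 : 0 <= mu by exact: sqrtr_ge0.
have muE : mu ^+ 2 = m by rewrite sqr_sqrtr // ltW.
set r := Num.sqrt s.
have r0 : 0 < r by rewrite sqrtr_gt0.
have rE : r ^+ 2 = s by rewrite sqr_sqrtr // ltW.
have /eqP := stationary_eigenpair MT X_crit v1 Sv.
rewrite mulf_eq0 subr_eq0 eq_sym (negPf s1) /= subr_eq0 => /eqP gE.
have gle : frob_inner (X *m v) (G *m v) <= frob_norm (X *m v) * frob_norm G.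
  rewrite -frob_inner_rank1 -(frob_norm_rank1 (X *m v) v1).
  exact: frob_inner_le.
have xv : mu * frob_norm (X *m v) <= r.
  rewrite -ler_sqr ?nnegrE ?mulr_ge0 ?frob_norm_ge0 ?(ltW r0) //.
  rewrite exprMn frob_norm_sq muE rE; apply: (le_trans (gram_form_ge v)).
  by rewrite Sv frob_innerZr v1 mulr1.
have gn : mu * frob_norm G <= K0 + p.+1%:R * L * C.
  apply: (le_trans (ler_wpM2l mu0 (frob_grad_le f_lip _))).
  rewrite mulrDr lerD2l mulrCA -mulrA [leRHS]mulrCA ler_wpM2l //.
  exact: dissolving_norm_le.
have xg : (mu * frob_norm (X *m v)) * (mu * frob_norm G)
    <= r * (K0 + p.+1%:R * L * C).
  by apply: ler_pM => //; rewrite mulr_ge0 ?frob_norm_ge0.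
have mg := ler_wpM2l (ltW m_gt0) gle.
have mgE : m * (frob_norm (X *m v) * frob_norm G)
   = (mu * frob_norm (X *m v)) * (mu * frob_norm G) by rewrite -muE; ring.
rewrite -(ler_pM2l r0).
have -> : r * (beta * m * (r * (1 + s))) = m * (beta * r ^+ 2 * (1 + s)) by ring.
rewrite rE -gE; lra.
Qed.

(** If the largest eigenvalue T of S exceeded 4, the previous bound at T itself,
    with C = sqrt T (1 + T) / 2, would be homogeneous in C and contradict the
    size of beta. So T <= 4 and the bound holds with C = 1, which gives
    sqrt s <= 1/8. *)
Lemma stationary_eigenvalue_dichotomy (s : R) (v : 'cV[R]_p) :
  frob_inner v v = 1 -> S *m v = s *: v -> s = 1 \/ s <= 1 / 64.
Proof.
move=> v1 Sv.
have ST : S^T = S by exact: gram_tr.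
have NST : (- S)^T = - S by rewrite linearN /= ST.
have [t [w [w1 Sw t_le]]] := min_eigenvector p_gt0 NST.
have {}Sw : S *m w = (- t) *: w.
  by rewrite scaleNr -Sw mulNmx opprK.
have S_le (u : 'cV[R]_p) : frob_inner u (S *m u) <= - t * frob_inner u u.
  by have := t_le u; rewrite mulNmx -[- (S *m u)]scaleN1r frob_innerZr; lra.
have K0_ge0 : 0 <= K0 by rewrite mulr_ge0 ?sqrtr_ge0.
have PL_ge0 : 0 <= p.+1%:R * L by rewrite mulr_ge0.
have bm_gt0 : 0 < beta * m by rewrite mulr_gt0.
have large : 12 * (K0 + p.+1%:R * L) <= beta * m.
  by move: beta_large PL_ge0; rewrite /K0 /mu; lra.
have [s1|s1] := eqVneq s 1; [by left|right].
have [s0|s0] := leP s 0; first by lra.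
have [t4|t4] := leP (- t) 4.
  have form u := shrink_form_le1 ST S_le u t4.
  have := stationary_eigenvalue_bound ler01 _ v1 Sv s1 s0.
  rewrite expr1n => h.
  have {}h : beta * m * (Num.sqrt s * (1 + s)) <= 3 / 2 * (K0 + p.+1%:R * L * 1).
    by apply: h => u; rewrite mul1r; exact: form.
  set r := Num.sqrt s in h.
  have r0 : 0 < r by rewrite sqrtr_gt0.
  have rE : r ^+ 2 = s by rewrite sqr_sqrtr // ltW.
  have r8 : r <= 1 / 8.
    rewrite -(ler_pM2l bm_gt0).
    have : 0 <= beta * m * (r * s) by rewrite !mulr_ge0 // ltW.
    lra.
  have := ler_pM (ltW r0) (ltW r0) r8 r8.
  rewrite -expr2 rE; lra.
exfalso.
set T := - t in t4 S_le Sw.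
have T0 : 0 < T by lra.
have form u := shrink_form_le ST gram_form_ge0 S_le u (ltW t4).
set r := Num.sqrt T.
have r0 : 0 < r by rewrite sqrtr_gt0.
have rE : r ^+ 2 = T by rewrite sqr_sqrtr // ltW.
have r2 : 2 <= r.
  by rewrite -ler_sqr ?nnegrE ?(ltW r0) // rE expr2; lra.
pose C := r * (1 + T) / 2.
have C0 : 0 <= C by rewrite /C !mulr_ge0 ?(ltW r0) //; lra.
have C1 : 1 <= C.
  have : 0 <= (r - 2) * (1 + T) by rewrite mulr_ge0 //; lra.
  rewrite /C; lra.
have T1 : T != 1 by apply/eqP => T1; rewrite T1 in t4; lra.
have := stationary_eigenvalue_bound C0 _ w1 Sw T1 T0.
have C2 : C ^+ 2 = T * (1 + T) ^+ 2 / 4 by rewrite /C -rE; field.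
rewrite C2 => /(_ form); rewrite -/r.
have -> : r * (1 + T) = 2 * C by rewrite /C; field.
have : K0 * 1 <= K0 * C by rewrite ler_wpM2l.
have : 12 * (K0 + p.+1%:R * L) * C <= beta * m * C by rewrite ler_wpM2r.
have : 0 < beta * m * C by rewrite mulr_gt0 //; lra.
lra.
Qed.

End StationarySpectrum.

(** * A direction of negative curvature *)

Section HessianRankOne.
Context {R : realType} {n p : nat}.
Variables (f : 'M[R]_(n, p) -> R^o) (M : 'M[R]_n) (beta : R) (X : 'M[R]_(n, p)).
Variables (s : R) (v : 'cV[R]_p) (w : 'cV[R]_n).
Let q := frob_inner w (M *m w).
(* The last three hypotheses hold both for w = X v, where q = s, and for X v = 0,
   X^T M w = 0, where s = 0; stating them avoids a case distinction. *)
Hypotheses (MT : M^T = M) (v1 : frob_inner v v = 1)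
  (Sv : gram M X *m v = s *: v)
  (XMw : X^T *m M *m w = s *: v)
  (sXv : s *: (X *m v) = s *: w) (qXv : q *: (X *m v) = s *: w).
Let D := w *m v^T.

Lemma rank1_mul (y : 'cV[R]_p) : D *m y = frob_inner v y *: w.
Proof.
by rewrite /D -mulmxA [v^T *m y]mx11_scalar /frob_inner trace_mx11 mul_mx_scalar.
Qed.

Lemma dgram_rank1 : dgram M X D = (2 * s) *: (v *m v^T).
Proof.
rewrite /dgram /D mulmxA XMw trmx_mul trmxK -!mulmxA.
have -> : w^T *m (M *m X) = s *: v^T.
  by apply: trmx_inj; rewrite linearZ /= !trmx_mul !trmxK MT XMw.
by rewrite -scalemxAr -scalemxAl -scalerDl; congr (_ *: _); lra.
Qed.

Lemma half_dgram_rank1 : 2^-1 *: dgram M X D = s *: (v *m v^T).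
Proof. by rewrite dgram_rank1 scalerA mulKf ?pnatr_eq0. Qed.

(** Along such a rank-one direction the derivative of the dissolving map acts as
    a scalar, so the Hessian of f is only ever evaluated at D itself. *)
Lemma ddissolving_rank1 : ddissolving M X D = (3 / 2 * (1 - s)) *: D.
Proof.
have ST := gram_tr X MT.
have shT : v^T *m ((3 / 2)%:M - 2^-1 *: gram M X) = ((3 - s) / 2) *: v^T.
  have TT : ((3 / 2)%:M - 2^-1 *: gram M X)^T = (3 / 2)%:M - 2^-1 *: gram M X.
    by rewrite linearB /= tr_scalar_mx linearZ /= ST.
  by apply: trmx_inj; rewrite trmx_mul TT [in RHS]linearZ /= !trmxK (eigen_shrink Sv).
rewrite /ddissolving half_dgram_rank1 -scalemxAr mulmxA scalemxAl sXv -scalemxAl.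
rewrite /D -mulmxA shT -scalemxAr -scalerBl; congr (_ *: _); lra.
Qed.

(** Every matrix in the Hessian is applied to v on the right and paired with w on
    the left. The derivatives of the shrinking factor, of M X, and of X^T in
    sym (X^T G) each contribute - s <w, G v>, and the terms in the Hessian of f
    combine to (3 - s) / 2 - s = 3/2 (1 - s) times <w, H v>, where H itself
    carries another factor 3/2 (1 - s). *)
Lemma penalty_hess_rank1 :
  frob_inner D (penalty_hess f M beta X D) =
  (3 / 2 * (1 - s)) ^+ 2 * frob_inner D (hess f (dissolving M X) D)
  - 3 * s * frob_inner w (grad f (dissolving M X) *m v)
  + beta * (q * (s ^+ 2 - 1) + 4 * s ^+ 3).
Proof.
set tau := 3 / 2 * (1 - s).
have Mw (y : 'cV[R]_p) : frob_inner w (M *m (X *m y)) = s * frob_inner v y.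
  have -> : M *m (X *m y) = (X^T *m M)^T *m y.
    by rewrite trmx_mul trmxK MT mulmxA.
  by rewrite -frob_inner_mull XMw frob_innerZl.
have MD (y : 'cV[R]_p) : frob_inner w (M *m (D *m y)) = q * frob_inner v y.
  by rewrite rank1_mul -scalemxAr frob_innerZr mulrC.
have Dv : D *m v = w by rewrite rank1_mul v1 scale1r.
rewrite /penalty_hess ddissolving_rank1 half_dgram_rank1 dgram_rank1.
set G := grad f _; set H := hess f _ _.
have HE : H = tau *: hess f (dissolving M X) D by rewrite /H /hess linearZ.
have hE : frob_inner w (H *m v) = tau * frob_inner D (hess f (dissolving M X) D).
  by rewrite HE -scalemxAl frob_innerZr /D frob_inner_rank1.
have Pv : (v *m v^T) *m v = v.
  by rewrite -mulmxA [v^T *m v]mx11_scalar -trace_mx11 [\tr _]v1 mulmx1.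
set Q := (2 * s) *: _ *m _ + _.
have Qv : Q *m v = (4 * s ^+ 2) *: v.
  rewrite /Q mulmxDl -(mulmxA _ (gram M X) v) -(mulmxA (gram M X)) Sv.
  rewrite -!scalemxAl -!scalemxAr Pv Sv.
  by rewrite !scalerA -scalerDl; congr (_ *: _); ring.
rewrite [frob_inner D (_ + _)]frob_inner_rank1 !(mulmxDl, mulNmx) -scalemxAl mulmxDl.
rewrite -!(mulmxA _ _ v) (eigen_shrink Sv) (eigen_sq _ Sv) Qv -scalemxAl Pv.
rewrite -!(mulmxA M) !(frob_innerDr, frob_innerZr).
have Ni (y : 'cV[R]_n) : frob_inner w (- y) = - frob_inner w y.
  by rewrite -scaleN1r frob_innerZr mulN1r.
rewrite !(frob_innerDr, frob_innerZr, Ni).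
have XG : q * frob_inner v (X^T *m G *m v) = s * frob_inner w (G *m v).
  by rewrite -mulmxA -frob_inner_mull -!frob_innerZl qXv.
have XH : s * frob_inner v ((D^T *m G + X^T *m H) *m v)
    = s * frob_inner w (G *m v) + s * frob_inner w (H *m v).
  rewrite mulmxDl frob_innerDr -!(mulmxA _ _ v) -!frob_inner_mull Dv mulrDr.
  by congr (_ + _); rewrite -!frob_innerZl sXv.
rewrite !Mw !MD -!scalemxAr !frob_innerZr !sym_part_form XG XH v1 hE /tau; lra.
Qed.

End HessianRankOne.

Section SaddleDirection.
Context {R : realType} {n p : nat}.
Variables (f : 'M[R]_(n, p) -> R^o) (M : 'M[R]_n) (beta : R) (X : 'M[R]_(n, p)).
Variables (L m s : R) (v : 'cV[R]_p).
Hypotheses (p_le_n : (p <= n)%N)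
  (MT : M^T = M) (beta_gt0 : 0 < beta)
  (m_gt0 : 0 < m) (L_ge0 : 0 <= L) (f_lip : lipschitz_grad L f)
  (m_le : forall u : 'cV[R]_n, m * frob_inner u u <= frob_inner u (M *m u))
  (beta_large : 36 * L <= beta * m)
  (X_crit : penalty_grad f M beta X = 0)
  (f_hess : differentiable (grad f) (dissolving M X))
  (v1 : frob_inner v v = 1) (Sv : gram M X *m v = s *: v)
  (s_small : s <= 1 / 64).

(** Take w = X v unless it vanishes. If X v = 0 then s = 0 and M X has rank less
    than p <= n, so some w <> 0 satisfies w^T M X = 0. *)
Lemma saddle_direction : exists w : 'cV[R]_n,
  [/\ w != 0, X^T *m M *m w = s *: v, s *: (X *m v) = s *: w &
      frob_inner w (M *m w) *: (X *m v) = s *: w].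
Proof.
have v0 : v != 0.
  apply/eqP => v0; move/eqP: v1.
  by rewrite v0 frob_inner0r eq_sym oner_eq0.
have [Xv0|Xv0] := eqVneq (X *m v) 0; last first.
  exists (X *m v); split=> //; first by rewrite mulmxA.
  by rewrite gram_form Sv frob_innerZr v1 mulr1.
have s0 : s = 0.
  have : s *: v = 0 by rewrite -Sv /gram -mulmxA Xv0 mulmx0.
  by move/eqP; rewrite scaler_eq0 (negPf v0) orbF => /eqP.
have rk : (\rank (M *m X) < p)%N.
  rewrite ltn_neqAle rank_leq_col andbT -mxrank_tr; apply/negP => free.
  have := mulmx_free_eq0 v^T free.
  by rewrite -trmx_mul -mulmxA Xv0 mulmx0 !trmx_eq0 eqxx (negPf v0).
have : kermx (M *m X) != 0.
  by rewrite -mxrank_eq0 mxrank_ker -lt0n subn_gt0 (leq_trans rk).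
case/rowV0Pn => r /sub_kermxP rMX r0.
exists r^T; rewrite Xv0 s0 !scale0r scaler0 trmx_eq0; split=> //.
by apply: trmx_inj; rewrite !trmx_mul !trmxK MT rMX trmx0.
Qed.

(** In units of beta q, where q = <w, M w> > 0, the three terms of the Hessian form
    are at most 9/4 * 1/36 = 1/16, at most 0, and 5 s^2 - 1. *)
Lemma penalty_hess_neg : exists D : 'M[R]_(n, p),
  D != 0 /\ frob_inner D (penalty_hess f M beta X D) < 0.
Proof.
have [w [w0 XMw sXv qXv]] := saddle_direction.
have s_le := s_small.
pose D := w *m v^T; set q := frob_inner w (M *m w) in qXv.
have Dn : frob_norm D = frob_norm w by exact: frob_norm_rank1.
have nw : 0 < frob_norm w by exact: frob_norm_gt0.
have ww : 0 < frob_inner w w by exact: frob_inner_gt0.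
have mq : m * frob_inner w w <= q by exact: m_le.
have q0 : 0 < q by apply: lt_le_trans mq; rewrite mulr_gt0.
exists D; split.
  apply/eqP => D0; move: nw.
  by rewrite -Dn D0 frob_norm0 ltxx.
rewrite (penalty_hess_rank1 f beta MT v1 Sv XMw sXv qXv).
have s0 : 0 <= s.
  by have := gram_form_ge0 X m_gt0 m_le v; rewrite Sv frob_innerZr v1 mulr1.
(* Both sides evaluate <s X v, M w>. *)
have sq : s ^+ 2 = s * q.
  have : frob_inner (s *: (X *m v)) (M *m w) = s * q by rewrite sXv frob_innerZl.
  rewrite frob_innerZl frob_inner_mull mulmxA XMw frob_innerZr v1 => <-; ring.
(* Since s <> 1, the eigenpair identity gives <Xv, Gv> = 2/3 beta s (1 + s). *)
have sg : 0 <= s * frob_inner w (grad f (dissolving M X) *m v).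
  rewrite -frob_innerZl -sXv frob_innerZl.
  have /eqP := stationary_eigenpair MT X_crit v1 Sv.
  have s1 : 0 < 1 - s by lra.
  rewrite mulf_eq0 (gt_eqF s1) /= subr_eq0 => /eqP gE; rewrite mulr_ge0 //.
  have : 0 <= beta * s * (1 + s) by rewrite !mulr_ge0 ?(ltW beta_gt0) //; lra.
  lra.
have hD := frob_hess_le f_lip D f_hess.
rewrite Dn frob_norm_sq in hD.
have Lq : L * frob_inner w w <= beta * q / 36.
  rewrite -(ler_pM2l m_gt0).
  have h1 := ler_wpM2l L_ge0 mq.
  have h2 := ler_wpM2r (ltW q0) beta_large.
  lra.
have tau2 : (3 / 2 * (1 - s)) ^+ 2 <= 9 / 4.
  have : 0 <= s * (1 - s) by rewrite mulr_ge0 //; lra.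
  by rewrite expr2; lra.
have bq : 0 < beta * q by rewrite mulr_gt0.
have h1 : (3 / 2 * (1 - s)) ^+ 2 * frob_inner D (hess f (dissolving M X) D)
    <= 9 / 4 * (beta * q / 36).
  apply: (@le_trans _ _ ((3 / 2 * (1 - s)) ^+ 2 * (beta * q / 36))).
    by rewrite ler_wpM2l ?sqr_ge0 // (le_trans hD).
  by rewrite ler_wpM2r //; lra.
have s2 : s * s <= 1 / 64 * (1 / 64) by exact: ler_pM.
have h2 : beta * q * (s * s) <= beta * q * (1 / 64 * (1 / 64)).
  by rewrite ler_wpM2l // ltW.
have -> : q * (s ^+ 2 - 1) + 4 * s ^+ 3 = q * (5 * (s * s) - 1).
  have -> : s ^+ 3 = q * (s * s) by rewrite exprS sq; ring.
  by rewrite expr2; ring.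
lra.
Qed.

End SaddleDirection.

(** * The theorem *)

Theorem theorem3p12 (R : realType) (n p : nat) (p_ge1 : (1 <= p)%N)
  (p_le_n : (p <= n)%N)
  (kxi : nat) (Xi : probability (kxi.-tuple R) R)
  (fxi : kxi.-tuple R -> 'M[R]_(n, p) -> R^o)
  (ktheta : nat) (Theta : probability (ktheta.-tuple R) R)
  (Mtheta : ktheta.-tuple R -> 'M[R]_n)
  (f : 'M[R]_(n, p) -> R^o) (M : 'M[R]_n)
  (f_expectation : forall X, has_expectation Xi (fun xi => fxi xi X) (f X))
  (M_expectation : has_mx_expectation Theta Mtheta M)
  (Lg : R)
  (f_diff : forall X, differentiable f X)
  (f_lip : lipschitz_grad Lg f)
  (fxi_diff : {ae Xi, forall xi, forall X, differentiable (fxi xi) X})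
  (grad_expectation : forall X,
     has_mx_expectation Xi (fun xi => grad (fxi xi) X) (grad f X))
  (M_posdef : symmetric_posdef M)
  (f_hess : forall X, has_hessian f X)
  (beta betat : R) (beta_gt0 : 0 < beta)
  (betat_ge : penalty_bound f M Lg <= betat)
  (beta_ge : betat <= beta)
  (X : 'M[R]_(n, p))
  (X_stationary : stationary (penalty f M beta) X) :
  (X \in gen_stiefel M /\ stationary_on_stiefel f M X) \/
  (X \notin gen_stiefel M /\ strict_saddle (penalty f M beta) X).
Proof.
have n_gt0 : (0 < n)%N by exact: leq_trans p_le_n.
have MT : M^T = M by case: M_posdef.
have [m_gt0 kappa_ge1 m_le] := sigma_min_cond_number n_gt0 M_posdef.
have Lg_ge0 := lipschitz_grad_ge0 f_lip n_gt0 p_ge1.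
have [grad_h h_hess hessE] := penalty_has_hessian beta MT X f_diff f_hess.
have X_crit : penalty_grad f M beta X = 0 by case: X_stationary; rewrite grad_h.
set m := sigma_min M in m_gt0 m_le.
pose K := 3 * p.+1%:R * Lg + Num.sqrt m * frob_norm (grad f 0).
have K_ge0 : 0 <= K by rewrite addr_ge0 ?mulr_ge0 ?sqrtr_ge0.
have beta_large : 12 * K <= beta * m.
  rewrite -ler_pdivrMr //; apply: le_trans beta_ge; apply: le_trans betat_ge.
  rewrite /penalty_bound -/m -/K ler_pM2r ?invr_gt0 // ler_wpM2r //.
  by rewrite ler_peMr.
have ST := gram_tr X MT.
have [S1|[s [v [v1 Sv s_le]]]] := sym_eq1_or_small_eigenvalue p_ge1 ST
  (c := 1 / 64) ltac:(lra)
  (stationary_eigenvalue_dichotomy p_ge1 MT beta_gt0 m_gt0 Lg_ge0 f_lip m_le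
     beta_large X_crit).
- left; split; first by rewrite inE.
  split=> //; move: X_crit.
  have AX : dissolving M X = X.
    rewrite /dissolving -/(gram M X) S1 scale_scalar_mx mulr1 -raddfB /=.
    by rewrite (_ : 3 / 2 - 2^-1 = 1) ?mulmx1 //; lra.
  rewrite /penalty_grad AX S1 scale_scalar_mx mulr1 -raddfB /=.
  rewrite (_ : 3 / 2 - 2^-1 = 1); last by lra.
  by rewrite !mulmx1 subrr mulmx0 scaler0 addr0.
right; split.
  apply/negP; rewrite inE /gen_stiefel /= -/(gram M X) => S1.
  have s1 : s = 1.
    have := congr1 (frob_inner v) Sv.
    by rewrite S1 mul1mx frob_innerZr v1 mulr1.
  by move: s_le; rewrite s1; lra.
have Lg_large : 36 * Lg <= beta * m.
  apply: le_trans beta_large.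
  have : 0 <= p%:R * Lg by rewrite mulr_ge0.
  have : 0 <= Num.sqrt m * frob_norm (grad f 0) by rewrite mulr_ge0 ?sqrtr_ge0.
  by rewrite /K -(natr1 p); lra.
have [_ f_hessA] := f_hess (dissolving M X).
have [D [D0 D_neg]] := penalty_hess_neg p_le_n MT beta_gt0 m_gt0 Lg_ge0 f_lip
  m_le Lg_large X_crit f_hessA v1 Sv s_le.
split=> //.
have DD : 0 < frob_inner D D by exact: frob_inner_gt0.
exists (- frob_inner D (hess (penalty f M beta) X D) / frob_inner D D).
rewrite hessE; split; first by rewrite divr_gt0 // oppr_gt0.
exists D; split=> //.
by rewrite frob_norm_sq mulNr divfK ?opprK // gt_eqF.
Qed.
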